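(* Let $s\in\mathbb{R}$, $0<p<\infty$, $0<q\le\infty$ and $\varphi\in\mathcal{G}_p$. Let $A$ denote either $B$ or $F$. Whenever an $F$-space with a finite third index ($q$, $q_1$ or $q_2$) occurs, assume in addition that there exist $\varepsilon_0>0$ and $c_0>0$ such that $t^{\varepsilon_0-d/p}\varphi(t)\le c_0\,r^{\varepsilon_0-d/p}\varphi(r)$ for all $t\ge r>0$. (i) If $0<q_1\le q_2\le\infty$, then $A_{p,q_1}^{s,\varphi}(\mathbb{R}^d)\hookrightarrow A_{p,q_2}^{s,\varphi}(\mathbb{R}^d)$. (ii) For $\varepsilon>0$ and arbitrary $0<q_1,q_2\le\infty$, $A_{p,q_1}^{s+\varepsilon,\varphi}(\mathbb{R}^d)\hookrightarrow A_{p,q_2}^{s,\varphi}(\mathbb{R}^d)$. (iii) $B_{p,\min(p,q)}^{s,\varphi}(\mathbb{R}^d)\hookrightarrow F_{p,q}^{s,\varphi}(\mathbb{R}^d)\hookrightarrow B_{p,\max(p,q)}^{s,\varphi}(\mathbb{R}^d)$.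
   Context: $X\hookrightarrow Y$ means $X\subset Y$ with continuous natural embedding. $\mathcal{F}$ is the Fourier transform on $\mathcal{S}'(\mathbb{R}^d)$. Class $\mathcal{G}_p$: all nondecreasing $\varphi:(0,\infty)\to(0,\infty)$ such that $t^{-d/p}\varphi(t)\ge s^{-d/p}\varphi(s)$ for all $0<t\le s<\infty$. $\mathcal{Q}$ is the set of dyadic cubes $2^{-j}([0,1)^d+k)$, $j\in\mathbb{Z}$, $k\in\mathbb{Z}^d$; $\ell(P)$ is the side length of $P$; $j_P=-\log_2\ell(P)$; $j_P\vee0=\max(j_P,0)$. Resolution of unity: $\theta_0\in\mathcal{S}(\mathbb{R}^d)$ with $\theta_0(x)=1$ for $|x|\le1$ and $\theta_0(x)=0$ for $|x|\ge3/2$; $\theta_k(x)=\theta_0(2^{-k}x)-\theta_0(2^{-k+1}x)$, $k\in\mathbb{N}$. With $f_j=\mathcal{F}^{-1}(\theta_j\mathcal{F}f)$, the spaces consist of all $f\in\mathcal{S}'(\mathbb{R}^d)$ with finite quasi-norm (usual modification for $q=\infty$) $$\|f\mid B_{p,q}^{s,\varphi}(\mathbb{R}^d)\|=\sup_{P\in\mathcal{Q}}\frac1{\varphi(\ell(P))}\Big\{\sum_{j=j_P\vee0}^\infty\Big(\int_P|2^{js}f_j(x)|^p\,dx\Big)^{q/p}\Big\}^{1/q},$$ $$\|f\mid F_{p,q}^{s,\varphi}(\mathbb{R}^d)\|=\sup_{P\in\mathcal{Q}}\frac1{\varphi(\ell(P))}\Big\{\int_P\Big(\sum_{j=j_P\vee0}^\infty|2^{js}f_j(x)|^q\Big)^{p/q}dx\Big\}^{1/p}.$$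 *)

(* Defs.v *)
From HB Require Import structures.
From mathcomp Require Import all_boot all_order all_algebra.
From mathcomp Require Import complex.
From mathcomp Require Import all_classical all_reals all_analysis.

Set Implicit Arguments.
Unset Strict Implicit.
Unset Printing Implicit Defensive.

Import Order.TTheory GRing.Theory Num.Theory.
Import numFieldNormedType.Exports.

Local Open Scope classical_set_scope.
Local Open Scope ring_scope.

Section borel_rV.
Context (R : realType) (d : nat).

Let borel0 : <<s @open 'rV[R]_d >> set0.
Proof. exact: sigma_algebra0. Qed.

Let borelC A : <<s @open 'rV[R]_d >> A -> <<s @open 'rV[R]_d >> (~` A).
Proof. exact: sigma_algebraC. Qed.

Let borel_bigcup (F : (set 'rV[R]_d)^nat) :
  (forall i, <<s @open 'rV[R]_d >> (F i)) ->
  <<s @open 'rV[R]_d >> (\bigcup_i F i).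
Proof. exact: sigma_algebra_bigcup. Qed.

HB.instance Definition _ :=
  @isMeasurable.Build (sigma_display (@open 'rV[R]_d)) 'rV[R]_d
    <<s @open 'rV[R]_d >> borel0 borelC borel_bigcup.

End borel_rV.

Section lebesgue_rV.
Variable R : realType.
Notation TR := (measurableTypeR R).

Definition tcons n (x : TR * n.-tuple TR) : n.+1.-tuple TR :=
  [tuple of x.1 :: x.2].

Lemma measurable_tcons n : measurable_fun [set: TR * n.-tuple TR] (@tcons n).
Proof. by apply: measurable_cons. Qed.

(* The second case is [pushforward (lebesgue_measure \x^ lebesgue_tuple m)]
   along [tcons], as a bundled measure; inference cannot find the measurability
   proof, hence the explicit instance. *)
Fixpoint lebesgue_tuple n : {measure set (n.-tuple TR) -> \bar R} :=
  match n with
  | 0%N => dirac ([tuple] : 0.-tuple TR)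
  | m.+1 => measure_function_pushforward__canonical__measure_function_Measure
      (lebesgue_measure \x^ lebesgue_tuple m)%E (@measurable_tcons m)
  end.

Definition row_of_tuple n (t : n.-tuple TR) : 'rV[R]_n := \row_i tnth t i.

Lemma measurable_row_of_tuple n :
  measurable_fun [set: n.-tuple TR] (@row_of_tuple n).
Proof.
have mopen U : open U -> measurable (@row_of_tuple n @^-1` U).
  move=> oU.
  pose box (c : n.-tuple rat * nat) : set 'rV[R]_n :=
    [set x | forall i, `|x 0 i - ratr (tnth c.1 i)| < c.2.+1%:R^-1].
  have mbox c : measurable (@row_of_tuple n @^-1` box c).
    have -> : @row_of_tuple n @^-1` box c =
      \bigcap_(i in [set: 'I_n]) (fun t : n.-tuple TR => tnth t i) @^-1`
        ball (ratr (tnth c.1 i) : R) (c.2.+1%:R^-1).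
      apply/seteqP; split => t /= h i.
        by move=> _; move: (h i); rewrite mxE /ball/= distrC.
      by have := h i I; rewrite /= /ball/= distrC mxE.
    apply: fin_bigcap_measurable => // i _.
    rewrite -[X in measurable X]setTI; apply: measurable_tnth => //.
    by rewrite ball_itv; exact: measurable_itv.
  have -> : @row_of_tuple n @^-1` U =
    \bigcup_(c in [set c | box c `<=` U]) (@row_of_tuple n @^-1` box c).
    apply/seteqP; split => [t Ut|t [c /= + ct]]; last exact.
    move: oU; rewrite openE => /(_ _ Ut) /nbhs_ballP[e /= e0 eU].
    have [k ke] : exists k, k.+1%:R^-1 < e / 2 :> R.
      have e20 : 0 < e / 2 by rewrite divr_gt0.
      exists (Num.truncn (e / 2)^-1).
      by rewrite invf_plt ?posrE// truncnS_gt.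
    have k0 : 0 < k.+1%:R^-1 :> R by rewrite invr_gt0.
    have /choice[q hq] (i : 'I_n) :
        exists q : rat, `|tnth t i - ratr q| < k.+1%:R^-1 :> R.
      have [q] : exists q : rat,
          ratr q \in `](tnth t i - k.+1%:R^-1 : R), (tnth t i : R)[.
        by apply: rat_in_itvoo; rewrite ltrBlDr ltrDl.
      rewrite in_itv/= => /andP[q1 q2]; exists q.
      by rewrite ger0_norm ?subr_ge0 ?(ltW q2)// ltrBlDr addrC -ltrBlDr.
    exists ([tuple q i | i < n], k).
      move=> /= y hy; apply: eU; split=> // i j; rewrite ord1 mxE /ball/=.
      rewrite (_ : tnth t j - _ =
        (tnth t j - ratr (q j)) + (ratr (q j) - y 0 j)); last first.
        by rewrite addrA subrK.
      apply: (le_lt_trans (ler_normD _ _)).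
      rewrite (splitr e) ltrD//; first exact: lt_trans (hq j) ke.
      have := hy j; rewrite /= tnth_mktuple => h.
      by rewrite distrC; exact: lt_trans h ke.
    by move=> i; rewrite mxE tnth_mktuple.
  rewrite bigcup_mkcond; apply: countable_bigcupT_measurable => // c.
  by case: ifPn.
apply: (@measurability _ _ _ _ _ _ (@open 'rV[R]_n)) => //.
by move=> _ [U oU <-]; rewrite setTI; exact: mopen.
Qed.

(* The lemma after it characterizes this measure among the Borel measures. *)
Definition lebesgue_rV n : {measure set 'rV[R]_n -> \bar R} :=
  measure_function_pushforward__canonical__measure_function_Measure
    (lebesgue_tuple n) (@measurable_row_of_tuple n).

Lemma lebesgue_rV_box n (a b : 'rV[R]_n) : (forall i, a 0 i <= b 0 i) ->
  lebesgue_rV n [set x | forall i, a 0 i <= x 0 i < b 0 i] =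
  (\prod_i (b 0 i - a 0 i))%:E.
Proof.
move=> ab; rewrite [LHS]/=/pushforward.
pose box m (u v : 'I_m -> R) : set (m.-tuple TR) :=
  [set t | forall i, u i <= tnth t i < v i].
have mbox m (u v : 'I_m -> R) : measurable (box m u v).
  have -> : box m u v = \bigcap_(i in [set: 'I_m])
      (fun t : m.-tuple TR => tnth t i) @^-1` `[u i, v i[.
    apply/seteqP; split => t /= h i; first by move=> _; rewrite /= in_itv/=.
    by have := h i I; rewrite /= in_itv.
  apply: fin_bigcap_measurable => // i _.
  have mI : measurable (`[u i, v i[%classic : set TR) by exact: measurable_itv.
  by have := @measurable_tnth _ TR m i measurableT _ mI; rewrite setTI.
have vbox m (u v : 'I_m -> R) : (forall i, u i <= v i) ->
    lebesgue_tuple m (box m u v) = (\prod_i (v i - u i))%:E.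
  elim: m u v => [|m IH] u v uv.
    by rewrite big_ord0 /= diracE mem_set// => -[].
  rewrite [LHS]/=/pushforward.
  rewrite (_ : _ @^-1` _ = `[u ord0, v ord0[ `*`
      box m (u \o lift ord0) (v \o lift ord0)); last first.
    apply/seteqP; split => -[x t] /=; rewrite in_itv/=.
      move=> h; split; first by have := h ord0; rewrite tnth0.
      by move=> i; have := h (lift ord0 i); rewrite tnthS.
    move=> [h0 h] i; case: (unliftP ord0 i) => [j|] ->; last by rewrite tnth0.
    by rewrite tnthS; exact: h.
  have mI : measurable (`[u ord0, v ord0[%classic : set TR).
    exact: measurable_itv.
  rewrite (product_measure2E _ _ mI (mbox _ _ _)).
  rewrite IH => [|i]; last exact: uv.
  rewrite big_ord_recl EFinM; congr (_ * _)%E.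
  have := lebesgue_measure_itv `[u ord0, v ord0[; rewrite /= => ->.
  rewrite lte_fin; case: ltP (uv ord0) => [_ _|h h']; first by rewrite EFinB.
  by rewrite (@le_anti _ _ (u ord0) (v ord0)) ?h ?h'// subrr.
rewrite -(vbox _ (fun i => a 0 i) (fun i => b 0 i)) //.
apply: (congr1 (lebesgue_tuple n)).
by apply/seteqP; split => t /= h i; have := h i; rewrite mxE.
Qed.

End lebesgue_rV.

Section schwartz.
Context {R : realType} {d : nat}.
Local Notation E := 'rV[R]_d.
Local Notation C := R[i].
Implicit Types (u : E -> R) (phi psi g : E -> C) (T f h : (E -> C) -> C).

Definition dot (x y : E) : R := \sum_i x 0 i * y 0 i.

(* The library norm on matrices is the sup norm. *)
Definition enorm (x : E) : R := Num.sqrt (dot x x).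

(* The modulus as an element of [R]; the norm of [R[i]] takes values in [R[i]]. *)
Definition normc (z : C) : R := ComplexField.Normc.normc z.

Definition re_fun phi : E -> R := fun x => complex.Re (phi x).
Definition im_fun phi : E -> R := fun x => complex.Im (phi x).

Definition partial (i : 'I_d) u : E -> R := 'D_(delta_mx 0 i) u.

Definition partials (l : seq 'I_d) u : E -> R := foldr partial u l.

(* C^infinity: every iterated partial derivative is Frechet differentiable. *)
Definition smooth u : Prop := forall l x, differentiable (partials l u) x.

Definition cpartials (l : seq 'I_d) phi (x : E) : C :=
  Complex (partials l (re_fun phi) x) (partials l (im_fun phi) x).

Definition schwartz_seminorm (N : nat) phi : \bar R :=
  ereal_sup [set z | exists l x, (size l <= N)%N /\
    z = ((1 + enorm x) ^+ N * normc (cpartials l phi x))%:E].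

Definition schwartz phi : Prop :=
  [/\ smooth (re_fun phi), smooth (im_fun phi) &
      forall N, (schwartz_seminorm N phi < +oo)%E].

(* The seminorms increase with [N], so their balls are a neighbourhood base
   of the topology of S(R^d).  A tempered distribution is encoded as a
   functional on all functions which vanishes off S(R^d), so that Leibniz
   equality is equality of distributions. *)
Definition tempered : set ((E -> C) -> C) := [set T |
  [/\ forall phi, ~ schwartz phi -> T phi = 0,
      forall (a : C) phi psi, schwartz phi -> schwartz psi ->
        T (fun x => a * phi x + psi x) = a * T phi + T psi &
      forall phi (e : R), schwartz phi -> 0 < e ->
        exists N, exists2 delta : R, 0 < delta &
          forall psi, schwartz psi ->
            (schwartz_seminorm N (fun x => psi x - phi x)%R < delta%:E)%E ->
            normc (T psi - T phi) < e]].

Definition dist_sub T f : (E -> C) -> C := fun phi => T phi - f phi.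

Definition on_schwartz T : (E -> C) -> C :=
  fun phi => if `[< schwartz phi >] then T phi else 0.

Definition integrablec g : Prop :=
  (lebesgue_rV R d).-integrable setT (EFin \o re_fun g) /\
  (lebesgue_rV R d).-integrable setT (EFin \o im_fun g).

Definition integralc g : C :=
  Complex (Rintegral (lebesgue_rV R d) setT (re_fun g))
          (Rintegral (lebesgue_rV R d) setT (im_fun g)).

Definition expi (t : R) : C := Complex (cos t) (sin t).

Definition fourier phi : E -> C := fun xi =>
  ((2 * pi) `^ (- (d%:R / 2)))%:C%C *
  integralc (fun x => expi (- dot x xi) * phi x).

Definition inv_fourier phi : E -> C := fun x =>
  ((2 * pi) `^ (- (d%:R / 2)))%:C%C *
  integralc (fun xi => expi (dot x xi) * phi xi).

(* The operations on S'(R^d) are the transposes of those on S(R^d). *)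
Definition dist_fourier T := on_schwartz (fun phi => T (fourier phi)).

Definition dist_inv_fourier T := on_schwartz (fun phi => T (inv_fourier phi)).

Definition dist_mul g T := on_schwartz (fun phi => T (fun x => g x * phi x)).

Definition resolution_generator theta0 : Prop :=
  [/\ schwartz theta0,
      forall x, enorm x <= 1 -> theta0 x = 1 &
      forall x, 3 / 2 <= enorm x -> theta0 x = 0].

Definition theta (theta0 : E -> C) (k : nat) : E -> C :=
  if k is k'.+1
  then fun x => theta0 ((2 : R) ^- k'.+1 *: x) - theta0 ((2 : R) ^- k' *: x)
  else theta0.

(* [T] is the regular distribution given by the continuous function [g]. *)
Definition represents g T : Prop :=
  [/\ continuous (re_fun g), continuous (im_fun g) &
      forall phi, schwartz phi ->
        integrablec (fun x => g x * phi x) /\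
        T phi = integralc (fun x => g x * phi x)].

(* F^-1(theta_j F f) has a compactly supported Fourier transform, so by the
   Paley-Wiener-Schwartz theorem it is a smooth function of at most polynomial
   growth; [lp_piece] is that function, the only continuous one representing
   the distribution. *)
Definition lp_piece theta0 f (j : nat) : E -> C :=
  xget (fun=> 0) [set g | represents g
    (dist_inv_fourier (dist_mul (theta theta0 j) (dist_fourier f)))].

Definition Gclass (p : R) (vphi : R -> R) : Prop :=
  [/\ forall t, 0 < t -> 0 < vphi t,
      forall t r, 0 < t -> t <= r -> vphi t <= vphi r &
      forall t r, 0 < t -> t <= r ->
        r `^ (- (d%:R / p)) * vphi r <= t `^ (- (d%:R / p)) * vphi t].

Definition eps_condition (p : R) (vphi : R -> R) : Prop :=
  exists eps0 c0 : R, [/\ 0 < eps0, 0 < c0 &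
    forall t r, 0 < r -> r <= t ->
      t `^ (eps0 - d%:R / p) * vphi t <= c0 * (r `^ (eps0 - d%:R / p) * vphi r)].

(* The dyadic cube 2^-j ([0,1)^d + k), whose side length is 2^-j. *)
Definition cube (j : int) (k : 'rV[int]_d) : set E :=
  [set x | forall i, 2 ^ (- j) * (k 0 i)%:~R <= x 0 i
                     < 2 ^ (- j) * ((k 0 i)%:~R + 1)].

Definition side (j : int) : R := 2 ^ (- j).

Definition posz_part (j : int) : nat := `|Num.max j 0|%N.

Definition weighted_piece (s : R) theta0 f (j : nat) (x : E) : R :=
  normc ((2 `^ (j%:R * s))%:C%C * lp_piece theta0 f j x).

Inductive scale := Besov | Triebel.

(* In both quasi-norms the last case of the match is q = +oo (q = -oo is
   excluded by 0 < q). *)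
Definition Bnorm (s p : R) (q : \bar R) (vphi : R -> R) theta0 f : \bar R :=
  ereal_sup (range (fun Q : int * 'rV[int]_d =>
    let m := posz_part Q.1 in
    let I (j : nat) := (\int[lebesgue_rV R d]_(x in cube Q.1 Q.2)
      (weighted_piece s theta0 f j x `^ p)%:E)%E in
    ((vphi (side Q.1))^-1)%:E *
    match q with
    | r%:E => (\sum_(m <= j <oo) I j `^ (r / p)) `^ r^-1
    | _ => ereal_sup [set I j `^ p^-1 | j in [set j | (m <= j)%N]]
    end)%E).

Definition Fnorm (s p : R) (q : \bar R) (vphi : R -> R) theta0 f : \bar R :=
  ereal_sup (range (fun Q : int * 'rV[int]_d =>
    let m := posz_part Q.1 in
    let w := weighted_piece s theta0 f in
    ((vphi (side Q.1))^-1)%:E *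
    (\int[lebesgue_rV R d]_(x in cube Q.1 Q.2)
      match q with
      | r%:E => (\sum_(m <= j <oo) (w j x `^ r)%:E) `^ (p / r)
      | _ => ereal_sup [set (w j x)%:E | j in [set j | (m <= j)%N]] `^ p
      end) `^ p^-1)%E).

Definition Anorm (A : scale) :=
  match A with Besov => Bnorm | Triebel => Fnorm end.

Definition space (norm : ((E -> C) -> C) -> \bar R) : set ((E -> C) -> C) :=
  [set f | tempered f /\ (norm f < +oo)%E].

(* Inclusion, and continuity of the inclusion map for the topologies of the
   two quasi-norms. *)
Definition embeds (normX normY : ((E -> C) -> C) -> \bar R) : Prop :=
  space normX `<=` space normY /\
  forall f, space normX f -> forall e : R, 0 < e ->
    exists2 delta : R, 0 < delta &
      forall h, space normX h ->
        (normX (dist_sub h f) < delta%:E)%E ->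
        (normY (dist_sub h f) < e%:E)%E.

End schwartz.
Arguments Gclass {R} d p vphi.
Arguments eps_condition {R} d p vphi.

(* Main.v *)
Require Import Defs.
From mathcomp Require Import all_boot all_order all_algebra.
From mathcomp Require Import complex.
From mathcomp Require Import all_classical all_reals all_analysis.
From mathcomp Require Import measurable_realfun ring.

Set Implicit Arguments.
Unset Strict Implicit.
Unset Printing Implicit Defensive.

Import Order.TTheory GRing.Theory Num.Theory.
Import numFieldNormedType.Exports.
Local Open Scope classical_set_scope.
Local Open Scope ring_scope.

(** Every embedding follows from an inequality norm_Y f <= C norm_X f in which
    C does not depend on f: applied to f it gives the inclusion, and applied to
    the difference of two distributions it gives continuity, with delta = e / C
    ([embeds_of_le]).  Both
    quasi-norms are suprema over dyadic cubes P of phi(l(P))^-1 times a mixed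
    norm of the functions w_j = |2^(js) f_j|, j >= max(j_P, 0): an l^q norm of
    L^p(P) norms for B and an L^p(P) norm of l^q norms for F.  Hence it suffices
    to compare the mixed norms on one cube, with a constant that does not depend
    on the cube, and this involves only nonnegative measurable functions.  The
    w_j are measurable because the chosen representatives of the pieces are
    continuous.

    (i) The l^q norm decreases as q grows ([lqnorm_nincr]), inside as well as
    outside the L^p norm, so C = 1.

    (ii) Passing from s + eps to s multiplies w_j by 2^(-j eps), and a geometric
    factor turns a bounded sequence into an l^q sequence ([lqnorm_geometric]).
    This bounds the norm with parameters s, q2 by the one with parameters
    s + eps, oo, which by (i) is at most the one with parameters s + eps, q1.

    (iii) By Minkowski's inequality a mixed norm is largest when the norm with
    the smaller exponent is the outer one.  Thus F <= B when q <= p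
    ([lpnorm_lqnorm_le]) and B <= F when p <= q ([lqnorm_lpnorm_le]).  The first
    is the triangle inequality in L^(p/q) for the functions w_j^q; the second is
    Minkowski's integral inequality in l^(q/p) for w_j^p, obtained from
    Hoelder's inequality ([lqnorm_integral_le]).  By (i), F with exponent q is
    at most F with exponent min(p,q) and at least F with exponent max(p,q), and
    there the two comparisons apply. *)

(** * Sequence quasi-norms *)

Section lq_norm.
Context {R : realType}.
Local Open Scope ereal_scope.
Implicit Types (a b : nat -> \bar R) (q : \bar R) (r : R).

Lemma le_poweR r (x y : \bar R) : (0 <= r)%R -> 0 <= x -> x <= y ->
  x `^ r <= y `^ r.
Proof.
move=> r0 x0 xy; apply: gt0_ler_poweR => //.
  by rewrite in_itv/= x0 leey.
by rewrite in_itv/= (le_trans x0 xy) leey.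
Qed.

Lemma poweRVK r (x : \bar R) : (0 < r)%R -> 0 <= x -> (x `^ r^-1) `^ r = x.
Proof. by move=> r0 x0; rewrite -poweRrM mulVf ?gt_eqF// poweRe1. Qed.

Lemma poweRKV r (x : \bar R) : (0 < r)%R -> 0 <= x -> (x `^ r) `^ r^-1 = x.
Proof. by move=> r0 x0; rewrite -poweRrM divff ?gt_eqF// poweRe1. Qed.

(** The default branch copies the one in the two quasi-norms of the theorem, so
    that they can be rewritten with this norm without a case distinction. *)
Definition lqnorm q a : \bar R :=
  match q with
  | r%:E => (\sum_(0 <= j <oo) a j `^ r) `^ r^-1
  | _ => ereal_sup (range a)
  end.

Lemma lqnorm_ge0 q a : (forall j, 0 <= a j) -> 0 <= lqnorm q a.
Proof.
move=> a0; case: q => [r| |]; first exact: poweR_ge0.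
all: by apply: (le_trans (a0 0%N)); apply: ereal_sup_ubound; exists 0%N.
Qed.

Lemma lqnorm_ubound q a : 0 < q -> (forall j, 0 <= a j) ->
  forall j, a j <= lqnorm q a.
Proof.
move=> q0 a0 j; case: q q0 => [r|_|//]; last first.
  by apply: ereal_sup_ubound; exists j.
rewrite lte_fin => r0 /=.
rewrite -[leLHS](poweRKV r0 (a0 j)); apply: le_poweR.
- by rewrite invr_ge0 ltW.
- exact: poweR_ge0.
- rewrite (@nneseries_split _ _ 0 j.+1); last by move=> k _; exact: poweR_ge0.
  rewrite add0n big_nat_recr//= -addeA addeCA leeDl//.
  rewrite adde_ge0//; last by apply: nneseries_ge0 => k _ _; exact: poweR_ge0.
  by apply: sume_ge0 => k _; exact: poweR_ge0.
Qed.

Lemma le_lqnorm q a b : 0 < q -> (forall j, 0 <= a j) ->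
  (forall j, a j <= b j) -> lqnorm q a <= lqnorm q b.
Proof.
move=> q0 a0 ab; case: q q0 => [r|_|//]; last first.
  apply: ub_ereal_sup => _ [j _ <-]; apply: (le_trans (ab j)).
  by apply: ereal_sup_ubound; exists j.
rewrite lte_fin => r0 /=; apply: le_poweR; first by rewrite invr_ge0 ltW.
  by apply: nneseries_ge0 => k _ _; exact: poweR_ge0.
apply: lee_nneseries => [j _ _|j _]; first exact: poweR_ge0.
by apply: le_poweR => //; exact: ltW.
Qed.

(** If S is the norm with exponent r then a_j <= S, hence for t >= r
    a_j^t <= S^(t-r) a_j^r, and the sum over j is at most S^(t-r) S^r = S^t. *)
Lemma lqnorm_nincr q1 q2 a : 0 < q1 -> q1 <= q2 -> (forall j, 0 <= a j) ->
  lqnorm q2 a <= lqnorm q1 a.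
Proof.
move=> q10 q12 a0.
have aS := @lqnorm_ubound q1 a q10 a0.
have S0 := @lqnorm_ge0 q1 a a0.
case: q2 q12 => [t| |]; last 2 first.
- by move=> _; apply: ub_ereal_sup => _ [j _ <-]; exact: aS.
- by rewrite leeNy_eq => /eqP q1E; move: q10; rewrite q1E.
case: q1 q10 aS S0 => [r|//|//]; rewrite lte_fin lee_fin => r0 aS S0 rt.
have t0 : (0 < t)%R by exact: lt_le_trans rt.
have SE : lqnorm r%:E a `^ r = \sum_(0 <= j <oo) a j `^ r.
  by rewrite /lqnorm poweRVK// nneseries_ge0// => k _ _; exact: poweR_ge0.
move: SE aS S0; set S := lqnorm r%:E a; clearbody S => SE aS S0.
case: S SE aS S0 => [S SE aS S0|_ _ _|//]; last by rewrite leey.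
rewrite -[leRHS](poweRKV t0 S0) {1}/lqnorm; apply: le_poweR.
- by rewrite invr_ge0 ltW.
- by apply: nneseries_ge0 => k _ _; exact: poweR_ge0.
have powE (x : \bar R) : x `^ t = x `^ (t - r) * x `^ r.
  by rewrite -poweRD ?subrK// add_neq0_poweRD_def// subrK gt_eqF.
rewrite (powE S%:E) SE poweR_EFin -nneseriesZl; last first.
  by move=> j _; exact: poweR_ge0.
apply: lee_nneseries => j; first by move=> _ _; exact: poweR_ge0.
move=> _; rewrite powE; apply: lee_wpmul2r; first exact: poweR_ge0.
by rewrite -poweR_EFin; apply: le_poweR => //; rewrite subr_ge0.
Qed.

(** The l^q norm of the product is at most sup_j b_j times the l^q norm of
    (rho^j)_j, the root of a convergent geometric series. *)
Lemma lqnorm_geometric q (rho : R) : 0 < q -> (0 <= rho < 1)%R ->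
  exists2 C : R, (0 < C)%R & forall b, (forall j, 0 <= b j) ->
    lqnorm q (fun j => (rho ^+ j)%:E * b j) <= C%:E * lqnorm +oo b.
Proof.
move=> q0 /andP[rho0 rho1].
have bB b j : b j <= lqnorm +oo b by apply: ereal_sup_ubound; exists j.
case: q q0 => [r|_|//]; last first.
  exists 1%R => // b b0; rewrite mul1e.
  apply: ub_ereal_sup => _ [j _ <-]; apply: le_trans (bB _ j).
  by rewrite gee_pMl// lee_fin ?exprn_ge0// exprn_ile1// ltW.
rewrite lte_fin => r0.
have z0 : (0 <= rho `^ r)%R by exact: powR_ge0.
have z1 : (rho `^ r < 1)%R.
  have -> : (1 = 1 `^ r :> R)%R by rewrite powR1.
  by apply: gt0_ltr_powR; rewrite ?nnegrE.
set z := (rho `^ r)%R in z0 z1.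
have z10 : (0 < (1 - z)^-1)%R by rewrite invr_gt0 subr_gt0.
have zsum : \sum_(0 <= j <oo) (z ^+ j)%:E <= ((1 - z)^-1)%:E.
  apply: lime_le.
    by apply: is_cvg_nneseries => j _ _; rewrite lee_fin exprn_ge0.
  apply: nearW => n; rewrite sumEFin lee_fin.
  rewrite -[leRHS]mul1r ler_pdivlMr ?subr_gt0// big_mkord mulrC.
  by rewrite -opprB mulNr -subrX1 opprB gerBl exprn_ge0.
exists ((1 - z)^-1 `^ r^-1)%R; first exact: powR_gt0.
move=> b b0; have := bB b; have := @lqnorm_ge0 +oo b b0.
case: (lqnorm +oo b) => [B B0 bleB|_ _|//]; last first.
  by rewrite gt0_muley ?lte_fin ?powR_gt0// leey.
rewrite -[B%:E](poweRKV r0 B0) -poweR_EFin -poweRM ?poweR_ge0//; last first.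
  by rewrite lee_fin ltW.
apply: le_poweR; first by rewrite invr_ge0 ltW.
  by apply: nneseries_ge0 => k _ _; exact: poweR_ge0.
rewrite muleC poweR_EFin; apply: le_trans.
  apply: (@lee_nneseries _ _ (fun j => (B `^ r)%:E * (z ^+ j)%:E)).
    by move=> j _ _; exact: poweR_ge0.
  move=> j _; rewrite poweRM// ?lee_fin ?exprn_ge0// muleC.
  rewrite poweR_EFin -powR_mulrn// -powRrM mulrC powRrM powR_mulrn//.
  apply: lee_wpmul2r; first by rewrite lee_fin exprn_ge0.
  by rewrite -poweR_EFin; apply: le_poweR => //; exact: ltW.
rewrite nneseriesZl; last by move=> j _; rewrite lee_fin exprn_ge0.
by apply: lee_wpmul2l => //; rewrite lee_fin powR_ge0.
Qed.

(** Moves the starting index of the sums over j >= m into the sequence, so that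
    all sequence norms run over the whole of nat. *)
Lemma lqnorm_shift q (a : nat -> \bar R) m :
  match q with
  | r%:E => (\sum_(m <= j <oo) a j `^ r) `^ r^-1
  | _ => ereal_sup [set a j | j in [set j | (m <= j)%N]]
  end = lqnorm q (fun j => a (j + m)%N).
Proof.
have supE : ereal_sup [set a j | j in [set j | (m <= j)%N]] =
    ereal_sup (range (fun j => a (j + m)%N)).
  congr ereal_sup; apply/seteqP; split => _ [i mi <-].
    by exists (i - m)%N => //; rewrite subnK.
  by exists (i + m)%N => //=; rewrite leq_addl.
case: q => [r| |] //=; rewrite -(nneseries_addn m)//.
by move=> i; exact: poweR_ge0.
Qed.

End lq_norm.

(** * Lebesgue quasi-norms and the triangle inequality for series *)

Section lp_norm.
Context d (T : measurableType d) (R : realType).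
Variables (mu : {measure set T -> \bar R}) (D : set T) (mD : measurable D).
Local Open Scope ereal_scope.
Implicit Types (f g : T -> \bar R) (h w : nat -> T -> R).

(** The functions are expected to be nonnegative: there is no absolute value. *)
Definition lpnorm (p : R) f : \bar R := (\int[mu]_(x in D) f x `^ p) `^ p^-1.

Lemma lpnorm_ge0 p f : 0 <= lpnorm p f.
Proof. exact: poweR_ge0. Qed.

Lemma measurable_fun_poweR p f : measurable_fun D f ->
  measurable_fun D (fun x => f x `^ p).
Proof. by move=> mf; apply: (measurableT_comp (measurable_poweR _)). Qed.

Lemma le_lpnorm p f g : (0 < p)%R -> measurable_fun D f -> measurable_fun D g ->
  (forall x, 0 <= f x) -> (forall x, f x <= g x) -> lpnorm p f <= lpnorm p g.
Proof.
move=> p0 mf mg f0 fg; apply: le_poweR; first by rewrite invr_ge0 ltW.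
  by apply: integral_ge0 => x _; exact: poweR_ge0.
apply: ge0_le_integral => //.
- by move=> x _; exact: poweR_ge0.
- exact: measurable_fun_poweR.
- exact: measurable_fun_poweR.
- by move=> x _; apply: le_poweR => //; exact: ltW.
Qed.

Lemma lpnormZ p (k : R) f : (0 < p)%R -> (0 <= k)%R -> measurable_fun D f ->
  (forall x, 0 <= f x) -> lpnorm p (fun x => k%:E * f x) = k%:E * lpnorm p f.
Proof.
move=> p0 k0 mf f0; rewrite /lpnorm.
under eq_integral do rewrite poweRM//.
rewrite ge0_integralZl//; first last.
- exact: poweR_ge0.
- by move=> x _; exact: poweR_ge0.
- exact: measurable_fun_poweR.
rewrite poweRM ?poweR_ge0 ?poweRKV//.
by apply: integral_ge0 => x _; exact: poweR_ge0.
Qed.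

(** Lowers the exponents of a mixed norm to the range in which the triangle
    inequality holds: |f|_p^r = |f^r|_(p/r). *)
Lemma lpnorm_poweR p r f : (0 < p)%R -> (0 < r)%R ->
  lpnorm p f `^ r = lpnorm (p / r) (fun x => f x `^ r).
Proof.
move=> p0 r0; rewrite /lpnorm -poweRrM invf_div mulrC; congr (_ `^ _).
by apply: eq_integral => x _; rewrite -poweRrM mulrCA divff ?mulr1 ?gt_eqF.
Qed.

Lemma measurable_lqnorm q (w : nat -> T -> \bar R) : 0 < q ->
  (forall j, measurable_fun D (w j)) -> (forall j x, 0 <= w j x) ->
  measurable_fun D (fun x => lqnorm q (fun j => w j x)).
Proof.
move=> q0 mw w0; case: q q0 => [r _|_|//].
  apply: measurable_fun_poweR; apply: ge0_emeasurable_sum => [k x _ _|k _].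
    exact: poweR_ge0.
  exact: measurable_fun_poweR.
rewrite (_ : (fun x => _) = (fun x => esups (w ^~ x) 0%N)).
  exact: measurable_fun_esups.
apply/funext => x; rewrite /lqnorm /esups/= /sdrop; congr ereal_sup.
by apply/seteqP; split => [_ [j _ <-]|_ [j _ <-]]; exists j.
Qed.

(** Extension by zero transfers Minkowski's inequality from the whole space to
    the set D. *)
Lemma lpnorm_Lnorm u (f : T -> R) : (0 < u)%R -> (forall x, 0 <= f x)%R ->
  lpnorm u (EFin \o f) = 'N[mu]_u%:E[EFin \o (f \_ D)].
Proof.
move=> u0 f0; rewrite unlock /lpnorm integral_mkcond; congr (_ `^ _).
apply: eq_integral => x _ /=; rewrite /patch; case: ifPn => _.
  by rewrite ger0_norm.
by rewrite normr0 powR0// gt_eqF.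
Qed.

Lemma lpnorm_sum_le u h n : (1 <= u)%R -> (forall j, measurable_fun D (h j)) ->
  (forall j x, 0 <= h j x)%R ->
  lpnorm u (fun x => \sum_(0 <= j < n) (h j x)%:E)
    <= \sum_(0 <= j < n) lpnorm u (EFin \o h j).
Proof.
move=> u1 mh h0; have u0 : (0 < u)%R by exact: lt_le_trans u1.
have mr (f : T -> R) : measurable_fun D f -> measurable_fun setT (f \_ D).
  by move=> mf; apply/(measurable_restrictT _ mD).
elim: n => [|n IH].
  rewrite big_nil /lpnorm.
  under eq_integral do rewrite big_nil poweR0r ?gt_eqF//.
  by rewrite integral0 poweR0r// invr_eq0 gt_eqF.
rewrite big_nat_recr//=.
pose s x := (\sum_(0 <= j < n) h j x)%R.
have s0 x : (0 <= s x)%R by exact: sumr_ge0.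
have ms : measurable_fun D s by exact: measurable_sum.
have -> : (fun x => \sum_(0 <= j < n.+1) (h j x)%:E) = EFin \o (s \+ h n)%R.
  by apply/funext => x; rewrite big_nat_recr//= sumEFin.
apply: (@le_trans _ _ (lpnorm u (EFin \o s) + lpnorm u (EFin \o h n))).
  rewrite !lpnorm_Lnorm//; last by move=> x; rewrite addr_ge0.
  have -> : ((s \+ h n) \_ D = (s \_ D) \+ (h n \_ D))%R.
    by apply/funext => x; rewrite /patch/=; case: ifP => //; rewrite addr0.
  by apply: minkowski_EFin => //; exact: mr.
apply: leeD => //; apply: le_trans IH.
by rewrite (_ : EFin \o s = (fun x => \sum_(0 <= j < n) (h j x)%:E))//;
  apply/funext => x; rewrite /= sumEFin.
Qed.

(** The finite triangle inequality passes to the limit by monotone convergence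
    of the u-th powers of the partial sums. *)
Lemma lpnorm_nneseries_le u h : (1 <= u)%R ->
  (forall j, measurable_fun D (h j)) -> (forall j x, 0 <= h j x)%R ->
  lpnorm u (fun x => \sum_(0 <= j <oo) (h j x)%:E)
    <= \sum_(0 <= j <oo) lpnorm u (EFin \o h j).
Proof.
move=> u1 mh h0; have u0 : (0 < u)%R by exact: lt_le_trans u1.
have V0 : (0 <= u^-1)%R by rewrite invr_ge0 ltW.
set M := leRHS.
have M0 : 0 <= M by apply: nneseries_ge0 => j _ _; exact: lpnorm_ge0.
pose S n x := \sum_(0 <= j < n) (h j x)%:E.
have S0 n x : 0 <= S n x by apply: sume_ge0 => j _; rewrite lee_fin.
have ndS x : nondecreasing_seq (S ^~ x).
  by move=> m n mn; apply: lee_sum_nneg_natr => // k _ _; rewrite lee_fin.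
have mS n : measurable_fun D (S n).
  by apply: emeasurable_sum => j; exact/measurable_EFinP.
have ndSu x : nondecreasing_seq (fun n => S n x `^ u).
  by move=> m n mn; apply: le_poweR; [exact: ltW|exact: S0|exact: ndS].
have mSu n : measurable_fun D (fun x => S n x `^ u).
  exact: measurable_fun_poweR.
have cSu x : cvgn (fun n => S n x `^ u) by exact: ereal_nondecreasing_is_cvgn.
rewrite -[leRHS](poweRKV u0 M0); apply: le_poweR => //.
  by apply: integral_ge0 => x _; exact: poweR_ge0.
apply: (@le_trans _ _ (\int[mu]_(x in D) limn (fun n => S n x `^ u))).
  apply: ge0_le_integral => //.
  - by move=> x _; exact: poweR_ge0.
  - apply: measurable_fun_poweR; apply: ge0_emeasurable_sum.
      by move=> *; rewrite lee_fin.
    by move=> j _; exact/measurable_EFinP.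
  - by apply: emeasurable_fun_cvg mSu _ => x _; exact: cSu.
  (* Each partial sum is at most L^(1/u), hence so is the series; this replaces
     the continuity of the power at the limit. *)
  - move=> x _; set L := leRHS.
    have SL n : S n x `^ u <= L.
      rewrite /L (cvg_lim _ (ereal_nondecreasing_cvgn (ndSu x)))//.
      by apply: ereal_sup_ubound; exists n.
    have L0 : 0 <= L by apply: le_trans (SL 0%N); exact: poweR_ge0.
    rewrite -[leRHS](poweRVK u0 L0); apply: le_poweR; first exact: ltW.
      by apply: nneseries_ge0 => j _ _; rewrite lee_fin.
    apply: lime_le; first by apply: is_cvg_nneseries => j _ _; rewrite lee_fin.
    apply: nearW => n; rewrite -[leLHS](poweRKV u0 (S0 n x)).
    by apply: le_poweR => //; exact: poweR_ge0.
rewrite monotone_convergence//; last by move=> n x _; exact: poweR_ge0.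
apply: lime_le.
  apply: ereal_nondecreasing_is_cvgn => m n mn; apply: ge0_le_integral => //.
  - by move=> x _; exact: poweR_ge0.
  - by move=> x _; exact: ndSu.
apply: nearW => n.
have SM : lpnorm u (S n) <= M.
  apply: (le_trans (lpnorm_sum_le n u1 mh h0)).
  by apply: nneseries_lim_ge => j _ _; exact: lpnorm_ge0.
rewrite -[leLHS](poweRVK u0); last first.
  by apply: integral_ge0 => x _; exact: poweR_ge0.
by apply: le_poweR => //; [exact: ltW|exact: lpnorm_ge0].
Qed.

(** The left-hand sides of this identity and the next are the expressions in the
    definitions of the two quasi-norms, for one cube. *)
Lemma lqnorm_lpnormE p q w m :
  match q with
  | r%:E =>
    (\sum_(m <= j <oo) (\int[mu]_(x in D) (w j x `^ p)%:E) `^ (r / p)) `^ r^-1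
  | _ => ereal_sup [set (\int[mu]_(x in D) (w j x `^ p)%:E) `^ p^-1
                   | j in [set j | (m <= j)%N]]
  end = lqnorm q (fun j => lpnorm p (EFin \o w (j + m)%N)).
Proof.
rewrite -(lqnorm_shift q (fun j => lpnorm p (EFin \o w j)) m).
case: q => [r| |] //; congr (_ `^ _); apply: eq_eseriesr => j _.
by rewrite /lpnorm -poweRrM mulrC.
Qed.

Lemma lpnorm_lqnormE p q w m :
  (\int[mu]_(x in D)
    match q with
    | r%:E => (\sum_(m <= j <oo) (w j x `^ r)%:E) `^ (p / r)
    | _ => ereal_sup [set (w j x)%:E | j in [set j | (m <= j)%N]] `^ p
    end) `^ p^-1 =
  lpnorm p (fun x => lqnorm q (fun j => (w (j + m)%N x)%:E)).
Proof.
rewrite /lpnorm; congr (_ `^ _); apply: eq_integral => x _.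
rewrite -(lqnorm_shift q (fun j => (w j x)%:E) m).
by case: q => [r| |] //; rewrite -poweRrM [(_^-1 * _)%R]mulrC.
Qed.

End lp_norm.

(** * Minkowski's inequality for mixed norms *)

Section mixed_norm.
Context {R : realType}.
Local Open Scope ereal_scope.

(** Hoelder's inequality for the counting measure, between the finitely
    supported sequence c^(u-1) and g: the conjugate exponent v satisfies
    (u-1) v = u, so the first factor is a power of the sum of the c_j^u. *)
Lemma hoelder_lqnorm (u : R) (c g : nat -> R) n : (1 < u)%R ->
  (forall j, 0 <= c j)%R -> (forall j, 0 <= g j)%R ->
  (\sum_(0 <= j < n) c j `^ (u - 1) * g j)%:E <=
  ((\sum_(0 <= j < n) c j `^ u) `^ (1 - u^-1))%:E *
    lqnorm u%:E (fun j => (g j)%:E).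
Proof.
move=> u1 c0 g0; have u0 : (0 < u)%R by exact: lt_trans u1.
have uB0 : (0 < u - 1)%R by rewrite subr_gt0.
pose b j := (if (j < n)%N then c j `^ (u - 1) else 0)%R.
have b0 j : (0 <= b j)%R by rewrite /b; case: ifP => _; rewrite ?powR_ge0.
pose v := (u / (u - 1))%R.
have v0 : (0 < v)%R by rewrite divr_gt0.
have uv : (v^-1 + u^-1 = 1)%R.
  by rewrite /v invf_div mulrBl mul1r divff ?gt_eqF// subrK.
have mnat (f : nat -> R) : measurable_fun setT f.
  by [].
have := hoelder counting (mnat b) (mnat g) v0 u0 uv.
rewrite !Lnorm_counting// invr1 poweRe1; last first.
  by apply: nneseries_ge0 => j _ _; exact: poweR_ge0.
have tail r : (0 < r)%R -> \sum_(0 <= j <oo) `|(EFin \o b) j| `^ r =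
    (\sum_(0 <= j < n) b j `^ r)%:E.
  move=> r0; rewrite (@nneseries_split _ _ 0 n); last first.
    by move=> k _; exact: poweR_ge0.
  rewrite add0n [X in _ + X](_ : _ = 0) ?adde0.
    by rewrite -sumEFin; apply: eq_bigr => j _; rewrite gee0_abs ?lee_fin.
  rewrite ereal_series_cond eseries0// => k _; rewrite andbT => nk.
  by rewrite [(EFin \o b) k]/= /b ltnNge nk abse0 poweR0r// gt_eqF.
rewrite (tail v v0) => H.
apply: le_trans (le_trans H _).
  rewrite (@nneseries_split _ _ 0 n); last by move=> k _; exact: poweR_ge0.
  rewrite add0n; apply: le_trans (leeDl _ _); last first.
    by apply: nneseries_ge0 => k _ _; exact: poweR_ge0.
  rewrite -sumEFin le_eqVlt; apply/orP; left; apply/eqP.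
  apply: eq_big_nat => j /andP[_ jn].
  rewrite poweRe1 ?abse_ge0// [X in `|X|](_ : _ = (b j * g j)%:E)//.
  by rewrite gee0_abs ?lee_fin ?mulr_ge0// /b jn.
rewrite poweR_EFin -[(1 - _)%R](_ : (v^-1 = _)%R); last by rewrite -uv addrK.
have -> : (\sum_(0 <= j < n) b j `^ v = \sum_(0 <= j < n) c j `^ u)%R.
  apply: eq_big_nat => j /andP[_ jn]; rewrite /b jn -powRrM mulrC.
  by rewrite divfK// gt_eqF.
have -> : lqnorm u%:E (fun j => (g j)%:E) =
  (\sum_(0 <= j <oo) `|(EFin \o g) j| `^ u) `^ u^-1.
  rewrite /lqnorm; congr (_ `^ _); apply: eq_eseriesr => j _.
  by rewrite [(EFin \o g) j]/= gee0_abs ?lee_fin.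
exact: lexx.
Qed.

Context d (T : measurableType d).
Variables (mu : {measure set T -> \bar R}) (D : set T) (mD : measurable D).
Implicit Types (g w : nat -> T -> R).

(** Minkowski's integral inequality in l^u.  Let G_j be the integral of g_j, M
    the right-hand side and S a partial sum of the G_j^u.  Integrating Hoelder's
    inequality for the sequences G_j^(u-1) and g_j(x) gives S <= S^(1-1/u) M,
    hence S^(1/u) <= M. *)
Lemma lqnorm_integral_le (u : R) g : (1 <= u)%R ->
  (forall j, measurable_fun D (g j)) -> (forall j x, 0 <= g j x)%R ->
  lqnorm u%:E (fun j => \int[mu]_(x in D) (g j x)%:E) <=
    \int[mu]_(x in D) lqnorm u%:E (fun j => (g j x)%:E).
Proof.
move=> + mg g0; have mge j : measurable_fun D (fun x => (g j x)%:E).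
  exact/measurable_EFinP.
have G0 j : 0 <= \int[mu]_(x in D) (g j x)%:E.
  by apply: integral_ge0 => x _; rewrite lee_fin.
rewrite le_eqVlt => /predU1P[<-|u1].
  rewrite /lqnorm invr1 poweRe1; last first.
    by apply: nneseries_ge0 => j _ _; exact: poweR_ge0.
  rewrite [leRHS](_ : _ = \int[mu]_(x in D) \sum_(0 <= j <oo) (g j x)%:E).
    rewrite integral_nneseries//; last by move=> j x _; rewrite lee_fin.
    by apply: lee_nneseries => j _; rewrite ?poweRe1.
  apply: eq_integral => x _; rewrite poweRe1; last first.
    by apply: nneseries_ge0 => j _ _; exact: poweR_ge0.
  by apply: eq_eseriesr => j _; rewrite poweRe1// lee_fin.
have u0 : (0 < u)%R by exact: lt_trans u1.
have l0 x : 0 <= lqnorm u%:E (fun j => (g j x)%:E).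
  by apply: lqnorm_ge0 => j; rewrite lee_fin.
have ml : measurable_fun D (fun x => lqnorm u%:E (fun j => (g j x)%:E)).
  by apply: measurable_lqnorm => // j x; rewrite lee_fin.
have GM j : \int[mu]_(x in D) (g j x)%:E <=
    \int[mu]_(x in D) lqnorm u%:E (fun j => (g j x)%:E).
  apply: ge0_le_integral => //; first by move=> x _; rewrite lee_fin.
  move=> x _; apply: (@lqnorm_ubound _ u%:E (fun j => (g j x)%:E)) => // i.
  by rewrite lee_fin.
have M0 : 0 <= \int[mu]_(x in D) lqnorm u%:E (fun j => (g j x)%:E).
  exact: integral_ge0.
have [->|Mfin] :=
  eqVneq (\int[mu]_(x in D) lqnorm u%:E (fun j => (g j x)%:E)) +oo.
  by rewrite leey.
set M := leRHS in GM M0 Mfin *.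
have MfinE : M \is a fin_num by rewrite ge0_fin_numE// ltey.
pose gam j := fine (\int[mu]_(x in D) (g j x)%:E).
have gamE j : (gam j)%:E = \int[mu]_(x in D) (g j x)%:E.
  by rewrite fineK// ge0_fin_numE//; apply: (le_lt_trans (GM j)); rewrite ltey.
have gam0 j : (0 <= gam j)%R by rewrite fine_ge0.
rewrite -[leRHS](poweRKV u0 M0) {1}/lqnorm; apply: le_poweR.
- by rewrite invr_ge0 ltW.
- by apply: nneseries_ge0 => j _ _; exact: poweR_ge0.
apply: lime_le; first by apply: is_cvg_nneseries => j _ _; exact: poweR_ge0.
apply: nearW => n; under eq_bigr do rewrite -gamE poweR_EFin.
rewrite sumEFin; set S := (\sum_(0 <= j < n) _)%R.
have S0 : (0 <= S)%R by apply: sumr_ge0 => j _; exact: powR_ge0.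
have [->|Sn0] := eqVneq S 0%R; first exact: poweR_ge0.
have Sgt0 : (0 < S)%R by rewrite lt0r Sn0.
have uV1 : (1 - u^-1 + u^-1 = 1)%R by rewrite subrK.
have SE : S%:E = \int[mu]_(x in D)
    (\sum_(0 <= j < n) gam j `^ (u - 1) * g j x)%:E.
  under eq_integral do rewrite -sumEFin.
  rewrite ge0_integral_sum//; first last.
  - by move=> j x _; rewrite lee_fin mulr_ge0// powR_ge0.
  - by move=> j; apply/measurable_EFinP; exact: measurable_funM.
  rewrite -sumEFin; apply: eq_bigr => j _.
  under eq_integral do rewrite EFinM.
  rewrite ge0_integralZl//; first last.
  - by rewrite lee_fin powR_ge0.
  - by move=> x _; rewrite lee_fin.
  by rewrite -gamE -EFinM mulrC mulr_powRB1.
have SM : S%:E <= (S `^ (1 - u^-1))%:E * M.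
  rewrite {1}SE -ge0_integralZl// ?lee_fin ?powR_ge0//.
  apply: ge0_le_integral => //.
  - move=> x _; rewrite lee_fin sumr_ge0// => j _.
    by rewrite mulr_ge0// powR_ge0.
  - apply/measurable_EFinP; apply: measurable_sum => j.
    exact: measurable_funM.
  - exact: measurable_funeM.
  - by move=> x _; exact: hoelder_lqnorm.
rewrite -(poweRVK u0 (_ : 0 <= S%:E)) ?lee_fin//.
apply: le_poweR; [exact: ltW|exact: poweR_ge0|].
move: SM; rewrite -(fineK MfinE) -EFinM poweR_EFin !lee_fin.
have SS : (S `^ (1 - u^-1) * S `^ u^-1 = S)%R.
  by rewrite -powRD uV1 ?powRr1// oner_eq0.
rewrite -{1}SS.
by rewrite ler_pM2l// powR_gt0.
Qed.

(** The r-th powers turn the claim into the triangle inequality in L^(p/r). *)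
Lemma lpnorm_lqnorm_le (p r : R) w : (0 < r)%R -> (r <= p)%R ->
  (forall j, measurable_fun D (w j)) -> (forall j x, 0 <= w j x)%R ->
  lpnorm mu D p (fun x => lqnorm r%:E (fun j => (w j x)%:E)) <=
    lqnorm r%:E (fun j => lpnorm mu D p (EFin \o w j)).
Proof.
move=> r0 rp mw w0; have p0 : (0 < p)%R by exact: lt_le_trans rp.
rewrite -(poweRKV r0 (lpnorm_ge0 _ _ _ _)) lpnorm_poweR//.
apply: le_poweR; [by rewrite invr_ge0 ltW|exact: lpnorm_ge0|].
rewrite [leLHS](_ : _ = lpnorm mu D (p / r)
    (fun x => \sum_(0 <= j <oo) (w j x `^ r)%:E)); last first.
  congr lpnorm; apply/funext => x; rewrite /lqnorm poweRVK//.
  by apply: nneseries_ge0 => j _ _; exact: poweR_ge0.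
apply: le_trans.
  apply: lpnorm_nneseries_le => //; first by rewrite ler_pdivlMr// mul1r.
    by move=> j; apply: (measurableT_comp (measurable_powR _)).
  by move=> j x; exact: powR_ge0.
by apply: lee_nneseries => j _; rewrite ?lpnorm_ge0// lpnorm_poweR.
Qed.

(** For finite q the p-th powers turn the claim into Minkowski's integral
    inequality in l^(q/p); for infinite q each w_j is below the supremum. *)
Lemma lqnorm_lpnorm_le (p : R) (q : \bar R) w : (0 < p)%R -> p%:E <= q ->
  (forall j, measurable_fun D (w j)) -> (forall j x, 0 <= w j x)%R ->
  lqnorm q (fun j => lpnorm mu D p (EFin \o w j)) <=
    lpnorm mu D p (fun x => lqnorm q (fun j => (w j x)%:E)).
Proof.
move=> p0 pq mw w0.
have q0 : 0 < q by apply: lt_le_trans pq; rewrite lte_fin.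
have wl j x : (w j x)%:E <= lqnorm q (fun j => (w j x)%:E).
  by apply: (@lqnorm_ubound _ q (fun j => (w j x)%:E)) => // i; rewrite lee_fin.
have ml : measurable_fun D (fun x => lqnorm q (fun j => (w j x)%:E)).
  by apply: measurable_lqnorm => // j; exact/measurable_EFinP.
case: q q0 pq wl ml => [r|_ _ wl ml|//]; last first.
  apply: ub_ereal_sup => _ [j _ <-]; apply: le_lpnorm => //.
  - exact/measurable_EFinP.
  - by move=> x; rewrite /= lee_fin.
  - by move=> x; exact: wl.
rewrite lte_fin lee_fin => r0 pr _ _.
have up1 : (1 <= r / p)%R by rewrite ler_pdivlMr// mul1r.
rewrite -(poweRKV p0 (lqnorm_ge0 _ (fun j => lpnorm_ge0 _ _ _ _))).
apply: le_poweR; [by rewrite invr_ge0 ltW|exact: poweR_ge0|].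
have lqp (a : nat -> \bar R) :
    lqnorm r%:E a `^ p = lqnorm (r / p)%:E (fun j => a j `^ p).
  rewrite /lqnorm -poweRrM invf_div mulrC; congr (_ `^ _).
  by apply: eq_eseriesr => j _; rewrite -poweRrM mulrCA divff ?mulr1 ?gt_eqF.
rewrite lqp; under [leRHS]eq_integral do rewrite lqp.
apply: le_trans (lqnorm_integral_le up1 (g := fun j x => w j x `^ p)%R _ _).
- rewrite le_eqVlt; apply/orP; left; apply/eqP; congr lqnorm.
  apply/funext => j; rewrite /lpnorm poweRVK//.
  by apply: integral_ge0 => x _; exact: poweR_ge0.
- by move=> j; apply: (measurableT_comp (measurable_powR _)).
- by move=> j x; exact: powR_ge0.
Qed.

End mixed_norm.

(** * Littlewood-Paley pieces on dyadic cubes *)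

Section pieces.
Context {R : realType} {d : nat}.
Local Notation E := 'rV[R]_d.
Implicit Types (f : (E -> R[i]) -> R[i]) (th : E -> R[i]) (s p : R).

Lemma continuous_measurable_rV (u : E -> R) :
  continuous u -> measurable_fun [set: E] u.
Proof.
move=> cu; apply: (measurability _ (RGenOpens.measurableE R)).
move=> _ [_ [a [b ->] <-]]; rewrite setTI; apply: sub_sigma_algebra.
by move/continuousP : cu; apply; exact: interval_open.
Qed.

Lemma measurable_cube (j : int) (k : 'rV[int]_d) :
  measurable (cube j k : set E).
Proof.
have -> : (cube j k : set E) = \bigcap_(i in [set: 'I_d])
    (fun x : E => x 0 i) @^-1`
      `[2 ^ (- j) * (k 0 i)%:~R, 2 ^ (- j) * ((k 0 i)%:~R + 1)[.
  apply/seteqP; split => x /= h i; first by move=> _; rewrite /= in_itv/=.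
  by have := h i I; rewrite /= in_itv.
apply: fin_bigcap_measurable => // i _; rewrite -[X in measurable X]setTI.
apply: continuous_measurable_rV => //; first exact: coord_continuous.
Qed.

(** A piece is either a continuous representative of its distribution or, if
    there is none, the default value zero. *)
Lemma lp_piece_continuous th f j :
  continuous (re_fun (lp_piece th f j)) /\
  continuous (im_fun (lp_piece th f j)).
Proof.
rewrite /lp_piece; case: xgetP => [g _ [] //|_].
by split => x; exact: cst_continuous.
Qed.

Lemma weighted_pieceE s th f j x :
  weighted_piece s th f j x =
  2 `^ (j%:R * s) * Num.sqrt (re_fun (lp_piece th f j) x ^+ 2 +
                              im_fun (lp_piece th f j) x ^+ 2).
Proof.
rewrite /weighted_piece /normc ComplexField.Normc.normcM.
rewrite /re_fun /im_fun; case: (lp_piece _ _ _ _) => a b /=.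
by rewrite expr0n/= addr0 sqrtr_sqr ger0_norm// powR_ge0.
Qed.

Lemma weighted_piece_ge0 s th f j x : 0 <= weighted_piece s th f j x.
Proof. by rewrite weighted_pieceE mulr_ge0 ?powR_ge0 ?sqrtr_ge0. Qed.

Lemma measurable_weighted_piece s th f j :
  measurable_fun [set: E] (weighted_piece s th f j).
Proof.
rewrite (funext (weighted_pieceE s th f j)).
have [cre cim] := lp_piece_continuous th f j.
apply: measurable_funM => //.
apply: (measurableT_comp (continuous_measurable_fun (@sqrt_continuous R))).
by apply: measurable_funD; apply: measurable_funX;
  exact: continuous_measurable_rV.
Qed.

(** The starting index m only helps: 2^(-(j+m) eps) <= 2^(-j eps), so the
    constant obtained from the geometric factor is the same on every cube. *)
Lemma weighted_piece_shift s (eps : R) th f j m x : 0 < eps ->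
  weighted_piece s th f (j + m) x <=
  (2 `^ (- eps)) ^+ j * weighted_piece (s + eps) th f (j + m) x.
Proof.
move=> eps0; rewrite !weighted_pieceE mulrA ler_wpM2r ?sqrtr_ge0//.
rewrite -powR_mulrn ?powR_ge0// -powRrM -powRD ?pnatr_eq0 ?implybT//.
rewrite ler_powR ?ler1n// -subr_ge0 natrD.
have -> : - eps * j%:R + (j%:R + m%:R) * (s + eps) - (j%:R + m%:R) * s =
  m%:R * eps by ring.
by rewrite mulr_ge0// ltW.
Qed.

Local Notation w s th f m := (fun j => weighted_piece s th f (j + m)).
Local Notation mu := (lebesgue_rV R d).

Lemma eq_sup_scaled (I : Type) (c : I -> R) (X Y : I -> \bar R) : X =1 Y ->
  ereal_sup (range (fun i => ((c i)%:E * X i)%E)) =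
  ereal_sup (range (fun i => ((c i)%:E * Y i)%E)).
Proof. by move=> /funext ->. Qed.

Lemma Bnorm_lqnorm s p (q : \bar R) (vphi : R -> R) th f :
  Bnorm s p q vphi th f =
  ereal_sup (range (fun Q : int * 'rV[int]_d => (((vphi (side Q.1))^-1)%:E *
    lqnorm q (fun j => lpnorm mu (cube Q.1 Q.2) p
      (EFin \o w s th f (posz_part Q.1) j)))%E)).
Proof.
rewrite /Bnorm; apply: eq_sup_scaled => Q.
exact: (lqnorm_lpnormE mu (cube Q.1 Q.2) p q
  (weighted_piece s th f) (posz_part Q.1)).
Qed.

Lemma Fnorm_lpnorm s p (q : \bar R) (vphi : R -> R) th f :
  Fnorm s p q vphi th f =
  ereal_sup (range (fun Q : int * 'rV[int]_d => (((vphi (side Q.1))^-1)%:E *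
    lpnorm mu (cube Q.1 Q.2) p (fun x =>
      lqnorm q (fun j => (w s th f (posz_part Q.1) j x)%:E)))%E)).
Proof.
rewrite /Fnorm; apply: eq_sup_scaled => Q.
exact: (lpnorm_lqnormE mu (cube Q.1 Q.2) p q
  (weighted_piece s th f) (posz_part Q.1)).
Qed.

Lemma sup_scaled_le (I : Type) (c : I -> R) (X Y : I -> \bar R) (C : R) :
  0 < C -> (forall i, 0 <= c i) -> (forall i, X i <= C%:E * Y i)%E ->
  (ereal_sup (range (fun i => (c i)%:E * X i)) <=
   C%:E * ereal_sup (range (fun i => (c i)%:E * Y i)))%E.
Proof.
move=> C0 c0 XY; apply: ub_ereal_sup => _ [i _ <-].
apply: (@le_trans _ _ ((c i)%:E * (C%:E * Y i))%E).
  by apply: lee_wpmul2l; rewrite ?lee_fin.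
rewrite muleCA; apply: lee_wpmul2l; first by rewrite lee_fin ltW.
by apply: ereal_sup_ubound; exists i.
Qed.

Lemma embeds_of_le (normX normY : ((E -> R[i]) -> R[i]) -> \bar R) (C : R) :
  0 < C -> (forall f, normY f <= C%:E * normX f)%E -> embeds normX normY.
Proof.
move=> C0 YX; split=> [f [tf fX]|f _ e e0].
  split=> //; apply: (le_lt_trans (YX f)); apply: lte_mul_pinfty => //.
  by rewrite lee_fin ltW.
exists (e / C); first exact: divr_gt0.
move=> h _ hX; apply: (le_lt_trans (YX _)).
by rewrite -lte_pdivlMl// -EFinM mulrC.
Qed.

End pieces.

(** * Comparison of the Besov and Triebel-Lizorkin quasi-norms *)

Section comparison.
Context {R : realType} {d : nat}.
Local Notation E := 'rV[R]_d.
Variables (th : E -> R[i]) (vphi : R -> R) (p : R).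
Hypotheses (p0 : 0 < p) (vphi0 : forall t, 0 < t -> 0 < vphi t).
Implicit Types (f : (E -> R[i]) -> R[i]) (q : \bar R) (s : R) (m : nat)
  (Q : int * 'rV[int]_d).
Local Notation w s f m j := (weighted_piece s th f (j + m)).
Local Notation mu := (lebesgue_rV R d).

Let mC Q : measurable (cube Q.1 Q.2 : set E).
Proof. exact: measurable_cube. Qed.

Let vphiV_ge0 Q : 0 <= (vphi (side Q.1))^-1.
Proof. by rewrite invr_ge0 ltW// vphi0// exprz_gt0. Qed.

Let w0 s f m x j : (0 <= (w s f m j x)%:E)%E.
Proof. by rewrite lee_fin weighted_piece_ge0. Qed.

Let mw Q s f m j : measurable_fun (cube Q.1 Q.2 : set E) (w s f m j).
Proof. by apply: measurable_funTS; exact: measurable_weighted_piece. Qed.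

Let mwe Q s f m j : measurable_fun (cube Q.1 Q.2 : set E) (EFin \o w s f m j).
Proof. exact/measurable_EFinP. Qed.

Let mlw Q q s f m : (0 < q)%E -> measurable_fun (cube Q.1 Q.2 : set E)
  (fun x => lqnorm q (fun j => (w s f m j x)%:E)).
Proof.
move=> q0; apply: measurable_lqnorm => // j.
exact: mwe.
Qed.

Lemma Bnorm_nincr s q1 q2 f : (0 < q1)%E -> (q1 <= q2)%E ->
  (Bnorm s p q2 vphi th f <= Bnorm s p q1 vphi th f)%E.
Proof.
move=> q10 q12; rewrite -[leRHS]mul1e !Bnorm_lqnorm.
apply: sup_scaled_le => // Q; rewrite mul1e.
by apply: lqnorm_nincr => // j; exact: lpnorm_ge0.
Qed.

Lemma Fnorm_nincr s q1 q2 f : (0 < q1)%E -> (q1 <= q2)%E ->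
  (Fnorm s p q2 vphi th f <= Fnorm s p q1 vphi th f)%E.
Proof.
move=> q10 q12; have q20 : (0 < q2)%E by exact: lt_le_trans q12.
rewrite -[leRHS]mul1e !Fnorm_lpnorm.
apply: sup_scaled_le => // Q; rewrite mul1e.
apply: le_lpnorm; [exact: mC|exact: p0|exact: mlw|exact: mlw|..].
- by move=> x; apply: lqnorm_ge0.
- by move=> x; apply: lqnorm_nincr.
Qed.

Let rho (eps : R) : 0 < eps -> 0 <= (2 `^ (- eps) : R) < 1.
Proof.
move=> eps0; rewrite powR_ge0/= powRN invf_lt1 ?powR_gt0//.
suff : 1 `^ eps < 2 `^ eps :> R by rewrite powR1.
by apply: gt0_ltr_powR; rewrite ?nnegrE// ltr1n.
Qed.

Lemma Bnorm_smoothness_gain (eps : R) q : 0 < eps -> (0 < q)%E ->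
  exists2 C : R, 0 < C & forall s f,
    (Bnorm s p q vphi th f <= C%:E * Bnorm (s + eps) p +oo vphi th f)%E.
Proof.
move=> eps0 q0; have [C C0 HC] := lqnorm_geometric q0 (rho eps0).
exists C => // s f; rewrite !Bnorm_lqnorm; apply: sup_scaled_le => // Q.
apply: le_trans (HC _ (fun j => lpnorm_ge0 _ _ _ _)).
apply: le_lqnorm => // j; first exact: lpnorm_ge0.
have z0 : 0 <= (2 `^ (- eps) : R) ^+ j by rewrite exprn_ge0// powR_ge0.
rewrite -(lpnormZ mu (mC Q) p0 z0 (mwe (s + eps) f (posz_part Q.1) j))//;
  last first.
  by move=> x; exact: w0.
apply: (le_lpnorm mu (mC Q) p0); [exact: mwe| |by move=> x; exact: w0|].
  by apply: measurable_funeM; exact: mwe.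
by move=> x; rewrite /= lee_fin weighted_piece_shift.
Qed.

Lemma Fnorm_smoothness_gain (eps : R) q : 0 < eps -> (0 < q)%E ->
  exists2 C : R, 0 < C & forall s f,
    (Fnorm s p q vphi th f <= C%:E * Fnorm (s + eps) p +oo vphi th f)%E.
Proof.
move=> eps0 q0; have [C C0 HC] := lqnorm_geometric q0 (rho eps0).
exists C => // s f; rewrite !Fnorm_lpnorm; apply: sup_scaled_le => // Q.
have l0 t r x : (0 <= lqnorm r (fun j => (w t f (posz_part Q.1) j x)%:E))%E.
  exact: lqnorm_ge0.
have y0 : (0 < +oo :> \bar R)%E by [].
rewrite -(lpnormZ mu (mC Q) p0 (ltW C0) (mlw (s + eps) f (posz_part Q.1) y0))//.
apply: (le_lpnorm mu (mC Q) p0); [exact: mlw| |exact: l0|].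
  by apply: measurable_funeM; exact: mlw.
move=> x; apply: le_trans (HC _ (w0 _ _ _ x)).
apply: le_lqnorm => // j.
by rewrite -EFinM lee_fin weighted_piece_shift.
Qed.

Lemma Fnorm_le_Bnorm s q f : (0 < q)%E -> (q <= p%:E)%E ->
  (Fnorm s p q vphi th f <= Bnorm s p q vphi th f)%E.
Proof.
case: q => [r|_|//]; last by rewrite leye_eq.
rewrite lte_fin lee_fin => r0 rp.
rewrite -[leRHS]mul1e Fnorm_lpnorm Bnorm_lqnorm.
apply: sup_scaled_le => // Q; rewrite mul1e.
apply: (lpnorm_lqnorm_le mu (mC Q) r0 rp).
- by move=> j; exact: mw.
- by move=> j x; exact: weighted_piece_ge0.
Qed.

Lemma Bnorm_le_Fnorm s q f : (p%:E <= q)%E ->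
  (Bnorm s p q vphi th f <= Fnorm s p q vphi th f)%E.
Proof.
move=> pq; rewrite -[leRHS]mul1e Fnorm_lpnorm Bnorm_lqnorm.
apply: sup_scaled_le => // Q; rewrite mul1e.
apply: (lqnorm_lpnorm_le mu (mC Q) p0 pq).
- by move=> j; exact: mw.
- by move=> j x; exact: weighted_piece_ge0.
Qed.

End comparison.

Theorem proposition4p9 (R : realType) (d : nat) (hd : (0 < d)%N)
    (theta0 : 'rV[R]_d -> R[i]) (htheta0 : resolution_generator theta0)
    (s p : R) (hp : 0 < p) (vphi : R -> R) (hvphi : Gclass d p vphi) :
  (* (i) *)
  (forall (A : scale) (q1 q2 : \bar R), (0 < q1)%E -> (q1 <= q2)%E ->
     (A = Triebel -> (q1 < +oo)%E \/ (q2 < +oo)%E -> eps_condition d p vphi) ->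
     embeds (Anorm A s p q1 vphi theta0) (Anorm A s p q2 vphi theta0)) /\
  (* (ii) *)
  (forall (A : scale) (eps : R) (q1 q2 : \bar R),
     0 < eps -> (0 < q1)%E -> (0 < q2)%E ->
     (A = Triebel -> (q1 < +oo)%E \/ (q2 < +oo)%E -> eps_condition d p vphi) ->
     embeds (Anorm A (s + eps) p q1 vphi theta0) (Anorm A s p q2 vphi theta0)) /\
  (* (iii) *)
  (forall q : \bar R, (0 < q)%E ->
     ((q < +oo)%E -> eps_condition d p vphi) ->
     embeds (Bnorm s p (Order.min p%:E q) vphi theta0)
            (Fnorm s p q vphi theta0) /\
     embeds (Fnorm s p q vphi theta0)
            (Bnorm s p (Order.max p%:E q) vphi theta0)).
Proof.
have [vphi0 _ _] := hvphi; split=> [A q1 q2 q10 q12 _|].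
  apply: (@embeds_of_le _ _ _ _ 1) => // f; rewrite mul1e.
  by case: A; [exact: Bnorm_nincr|exact: Fnorm_nincr].
split=> [A eps q1 q2 eps0 q10 q20 _|q q0 _].
  have [C C0 HC] : exists2 C : R, 0 < C & forall f,
      (Anorm A s p q2 vphi theta0 f <=
       C%:E * Anorm A (s + eps) p +oo vphi theta0 f)%E.
    case: A.
      have [C C0 HC] := Bnorm_smoothness_gain theta0 hp vphi0 eps0 q20.
      by exists C => // f; exact: HC.
    have [C C0 HC] := Fnorm_smoothness_gain theta0 hp vphi0 eps0 q20.
    by exists C => // f; exact: HC.
  apply: (embeds_of_le C0) => f; apply: le_trans (HC f) _.
  apply: lee_wpmul2l; first by rewrite lee_fin ltW.
  by case: A {HC}; [apply: Bnorm_nincr|apply: Fnorm_nincr] => //; rewrite leey.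
have pe0 : (0 < p%:E)%E by rewrite lte_fin.
split; apply: (@embeds_of_le _ _ _ _ 1) => // f; rewrite mul1e.
- have m0 : (0 < Order.min p%:E q)%E by rewrite lt_min pe0.
  apply: le_trans (Fnorm_nincr theta0 hp vphi0 s f m0 _) _.
    by rewrite ge_min lexx orbT.
  by apply: Fnorm_le_Bnorm => //; rewrite ge_min lexx.
- apply: le_trans (Bnorm_le_Fnorm theta0 hp vphi0 s f _) _.
    by rewrite le_max lexx.
  by apply: Fnorm_nincr => //; rewrite le_max lexx orbT.
Qed.
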